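(* Let $n\ge 3$, $k\in\{2,\ldots,n-1\}$, $T^{k,n}=(N_1,\ldots,N_t)$ the problem instance defined in the context (so $t=\binom{n-1}{k}2^k$), and $1\le s\le t$. Let $N$ be an optimal solution for $T^{k,n}$. Then $f_{T^{k,n}}(N_s)\ge \tfrac{3}{2}\,f_{T^{k,n}}(N)$.
   Context: Binary attributes $V_1,\ldots,V_n$, each with domain $\{0,1\}$. For $Q\subseteq\{V_1,\ldots,V_{n-1}\}$, $\mathrm{Inst}(Q)$ is the set of assignments of values in $\{0,1\}$ to the attributes of $Q$ (contexts). A (complete) CPT $N$ for $V_n$ consists of a parent set $Pa(N,V_n)\subseteq\{V_1,\ldots,V_{n-1}\}$ and, for each $\gamma\in\mathrm{Inst}(Pa(N,V_n))$, exactly one rule, either $\gamma:0\succ 1$ or $\gamma:1\succ 0$. A swap over $V_n$ is identified with an element $x\in\{0,1\}^{n-1}$; the vote of $N$ on $x$ is $0$ if the rule of $N$ whose context agrees with $x$ on $Pa(N,V_n)$ is of the form $\gamma:0\succ1$, and $1$ otherwise. $\Delta(N,N')$ is the number of swaps on which $N,N'$ vote differently. For a problem instance $T=(N_1,\ldots,N_t)$ (tuple of CPTs for $V_n$), $f_T(N)=\sum_{s=1}^t\Delta(N,N_s)$; an optimal solution for $T$ is a CPT for $V_n$ (any parent set $\subseteq\{V_1,\ldots,V_{n-1}\}$) minimizing $f_T$. The instance $T^{k,n}=(N_1,\ldots,N_t)$ has $t=\binom{n-1}{k}2^k$, with the indices $s$ in bijection with the pairs $(P,\gamma)$ where $P$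 is a $k$-element subset of $\{V_1,\ldots,V_{n-1}\}$ and $\gamma\in\mathrm{Inst}(P)$; the CPT $N_s$ corresponding to $(P,\gamma)$ has parent set $P$, the rule $\gamma:1\succ0$, and the rule $\gamma':0\succ1$ for every $\gamma'\in\mathrm{Inst}(P)\setminus\{\gamma\}$. *)

(* Defs.v *)
From HB Require Import structures.
From mathcomp Require Import all_boot all_order all_algebra.

Set Implicit Arguments.
Unset Strict Implicit.
Unset Printing Implicit Defensive.

(* V_1, ..., V_{n-1} are indexed by 'I_n.-1; attribute values 0 and 1 are
   [false] and [true]. *)

Definition Inst (n : nat) (Q : {set 'I_n.-1}) : finType :=
  {ffun {i : 'I_n.-1 | i \in Q} -> bool}.

Inductive pref := Pref01 (* 0 > 1 *) | Pref10 (* 1 > 0 *).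

Record cpt (n : nat) := Cpt {
  Pa : {set 'I_n.-1};
  rule : Inst Pa -> pref
}.

Definition swap (n : nat) : finType := {ffun 'I_n.-1 -> bool}.

Definition restr (n : nat) (Q : {set 'I_n.-1}) (x : swap n) : Inst Q :=
  [ffun i : {i : 'I_n.-1 | i \in Q} => x (val i)].

Definition vote (n : nat) (N : cpt n) (x : swap n) : bool :=
  if rule (restr (Pa N) x) is Pref01 then false else true.

Definition Delta (n : nat) (N N' : cpt n) : nat :=
  #|[set x : swap n | vote N x != vote N' x]|.

Definition f (n t : nat) (T : t.-tuple (cpt n)) (N : cpt n) : nat :=
  \sum_(s < t) Delta N (tnth T s).

Definition optimal (n t : nat) (T : t.-tuple (cpt n)) (N : cpt n) : Prop :=
  forall N' : cpt n, f T N <= f T N'.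

Definition ksubset (n k : nat) : finType := {P : {set 'I_n.-1} | #|P| == k}.

Definition kcontext (n k : nat) : finType := {P : ksubset n k & Inst (val P)}.

Definition single_cpt (n : nat) (P : {set 'I_n.-1}) (g : Inst P) : cpt n :=
  @Cpt n P (fun g' => if g' == g then Pref10 else Pref01).

Definition Tsize (n k : nat) : nat := 'C(n.-1, k) * 2 ^ k.

(* The instance T^{k,n}, for an arbitrary indexing [e] of the pairs (P, gamma);
   [e] is meant to be a bijection. *)
Definition Tkn (n k : nat) (e : 'I_(Tsize n k) -> kcontext n k) :
    (Tsize n k).-tuple (cpt n) :=
  [tuple single_cpt (tagged (e s)) | s < Tsize n k].

Lemma card_kcontext (n k : nat) : #|kcontext n k| = Tsize n k.
Proof.
rewrite card_tagged sumnE big_map big_enum /=.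
rewrite (eq_bigr (fun=> 2 ^ k)) => [|P _].
  rewrite sum_nat_const /Tsize card_sig -cardsE.
  by rewrite -[in RHS](card_ord n.-1) -card_draws.
by rewrite card_ffun card_bool card_sig (eqP (valP P)).
Qed.

Lemma kcontext_indexing (n k : nat) :
  exists e : 'I_(Tsize n k) -> kcontext n k, bijective e.
Proof.
by rewrite -card_kcontext; exists enum_val; exact: enum_val_bij.
Qed.

(* Main.v *)
Require Import Defs.
From mathcomp Require Import all_boot all_order all_algebra.
From mathcomp Require Import zify.

Set Implicit Arguments.
Unset Strict Implicit.
Unset Printing Implicit Defensive.

Import Order.TTheory GRing.Theory Num.Theory.

(** Put m = n - 1 and C = 'C(m, k).  Every swap receives exactly C votes 1 from
    the C * 2 ^ k input CPTs, since each k-subset of the attributes has exactly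
    one context agreeing with it.  Hence f(N) = C * 2 ^ m + a * C * (2 ^ k - 2),
    where a is the number of swaps on which N votes 1.  The optimum is reached at
    a = 0, whereas a = 2 ^ (m - k) for each input CPT; the claim then reduces to
    2 ^ k >= 4. *)

Lemma card_section_graph (I : finType) (T : I -> finType)
    (h : forall i, T i) :
  #|[set u : {i : I & T i} | h (tag u) == tagged u]| = #|I|.
Proof.
pose graph i := Tagged T (h i).
have graph_inj : injective graph by move=> i j [].
rewrite -(card_imset predT graph_inj); apply: eq_card => u.
rewrite inE; apply/eqP/imsetP => [|[j _ ->] //].
by case: u => i y /= <-; exists i.
Qed.

Lemma card_ffun_extension (A B : finType) (Q : {set A})
    (g : {ffun {i : A | i \in Q} -> B}) :
  #|[set x : {ffun A -> B} | [ffun i => x (val i)] == g]| = #|B| ^ #|~: Q|.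
Proof.
pose allowed (i : A) : pred B :=
  if insub i is Some j then pred1 (g j) else predT.
have -> : #|[set x : {ffun A -> B} | [ffun i => x (val i)] == g]|
          = #|family allowed|.
  apply: eq_card => x; rewrite inE; apply/eqP/familyP => [x_ext i | x_allowed].
    by rewrite /allowed; case: insubP => // j _ <-; rewrite inE -x_ext ffunE.
  apply/ffunP => j; rewrite ffunE.
  by have := x_allowed (val j); rewrite /allowed valK => /eqP.
rewrite card_family foldrE big_map big_enum -prod_nat_const [RHS]big_mkcond /=.
apply: eq_bigr => i _; rewrite inE /allowed.
case: insubP => [j -> _|/negbTE-> //]; exact: card1.
Qed.

Definition votes1 (n : nat) (N : cpt n) : {set swap n} := [set x | vote N x].

Definition supporters (n t : nat) (T : t.-tuple (cpt n)) (x : swap n) :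
    {set 'I_t} :=
  [set s | vote (tnth T s) x].

Lemma card_swap (n : nat) : #|swap n| = 2 ^ n.-1.
Proof. by rewrite card_ffun card_bool card_ord. Qed.

Lemma f_sum_swaps (n t : nat) (T : t.-tuple (cpt n)) (N : cpt n) :
  f T N = \sum_(x : swap n) #|[set s | vote N x != vote (tnth T s) x]|.
Proof.
rewrite /f /Delta; under eq_bigr do rewrite -sum1dep_card big_mkcond.
rewrite exchange_big; apply: eq_bigr => x _ /=.
by rewrite -big_mkcond sum1dep_card.
Qed.

Lemma f_supporters (n t : nat) (T : t.-tuple (cpt n)) (N : cpt n) :
  f T N = \sum_(x in votes1 N) (t - #|supporters T x|)
          + \sum_(x in ~: votes1 N) #|supporters T x|.
Proof.
rewrite f_sum_swaps (bigID (mem (votes1 N))) /=; congr (_ + _).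
  apply: eq_bigr => x; rewrite inE => ->; rewrite cardsCs card_ord.
  by congr (t - _); apply: eq_card => s; rewrite !inE; case: vote.
apply: eq_big => [x|x]; rewrite !inE // => /negbTE->.
by apply: eq_card => s; rewrite !inE; case: vote.
Qed.

Definition zero_cpt (n : nat) : cpt n := @Cpt n set0 (fun=> Pref01).

Lemma votes1_zero_cpt (n : nat) : votes1 (zero_cpt n) = set0.
Proof. by apply/setP => x; rewrite !inE. Qed.

Section UniformSupport.

Variables (n t c : nat) (T : t.-tuple (cpt n)).
Hypothesis card_supporters : forall x, #|supporters T x| = c.
Hypothesis minority : c.*2 <= t.

Lemma f_uniform_support (N : cpt n) :
  f T N = c * 2 ^ n.-1 + #|votes1 N| * (t - c.*2).
Proof.
rewrite f_supporters; under eq_bigr do rewrite card_supporters.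
under [X in _ + X]eq_bigr do rewrite card_supporters.
rewrite !sum_nat_const -card_swap -(cardsC (votes1 N)).
have -> : t - c = c + (t - c.*2) by lia.
by rewrite !mulnDr !(mulnC c) addnAC.
Qed.

Lemma f_optimal_uniform_support (N : cpt n) :
  optimal T N -> f T N = c * 2 ^ n.-1.
Proof.
move=> /(_ (zero_cpt n)).
rewrite !f_uniform_support votes1_zero_cpt cards0 mul0n.
by rewrite leq_add2l leqn0 => /eqP->; rewrite addn0.
Qed.

End UniformSupport.

Lemma vote_single_cpt (n : nat) (P : {set 'I_n.-1}) (g : Inst P) (x : swap n) :
  vote (single_cpt g) x = (restr P x == g).
Proof. by rewrite /vote /=; case: eqP. Qed.

Lemma card_votes1_single_cpt (n : nat) (P : {set 'I_n.-1}) (g : Inst P) :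
  #|votes1 (single_cpt g)| = 2 ^ (n.-1 - #|P|).
Proof.
have := card_ffun_extension g.
rewrite [#|~: P|]cardsCs setCK card_ord card_bool => <-.
by apply: eq_card => x; rewrite !inE vote_single_cpt.
Qed.

Lemma card_ksubset (n k : nat) : #|ksubset n k| = 'C(n.-1, k).
Proof. by rewrite card_sig -cardsE card_draws card_ord. Qed.

Lemma card_supporters_Tkn (n k : nat) (e : 'I_(Tsize n k) -> kcontext n k)
    (x : swap n) :
  bijective e -> #|supporters (Tkn e) x| = 'C(n.-1, k).
Proof.
move=> e_bij.
pose agreeing := [set u : kcontext n k | restr (val (tag u)) x == tagged u].
have -> : supporters (Tkn e) x = e @^-1: agreeing.
  by apply/setP => s; rewrite !inE tnth_mktuple vote_single_cpt.
rewrite on_card_preimset; last exact: onW_bij.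
rewrite -card_ksubset.
exact: (card_section_graph (fun P : ksubset n k => restr (val P) x)).
Qed.

Local Open Scope ring_scope.

Theorem theorem18 (n k : nat) (hn : (3 <= n)%N) (hk : (2 <= k <= n.-1)%N)
    (e : 'I_(Tsize n k) -> kcontext n k) (he : bijective e)
    (s : 'I_(Tsize n k)) (N : cpt n) (hN : optimal (Tkn e) N) :
  (f (Tkn e) (tnth (Tkn e) s))%:R >= (3%:R / 2%:R) * (f (Tkn e) N)%:R :> rat.
Proof.
rewrite mulrAC ler_pdivrMr ?ltr0n // -!natrM ler_nat.
have [k_ge2 k_le] := andP hk.
have four_le_2k : (4 <= 2 ^ k)%N by rewrite (@leq_pexp2l 2 2 k).
have minority : ('C(n.-1, k).*2 <= Tsize n k)%N by rewrite /Tsize; nia.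
have card_supp x : #|supporters (Tkn e) x| = 'C(n.-1, k)
  by exact: card_supporters_Tkn.
rewrite (f_optimal_uniform_support card_supp minority hN).
rewrite (f_uniform_support card_supp minority) tnth_mktuple.
rewrite card_votes1_single_cpt (eqP (valP (tag (e s)))) /Tsize.
have -> : (2 ^ n.-1 = 2 ^ (n.-1 - k) * 2 ^ k)%N by rewrite -expnD subnK.
by rewrite -muln2 -mulnBr; nia.
Qed.
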